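(* Let $(M,P_M^{\mathfrak h},\mu)$ be a quasi-hamiltonian space acted upon by a connected quasi-Poisson Lie group $G_D^{\mathfrak h}$, with moment map $\mu:M\to S=D/G$. Then, on any open set $\Omega\subset M$ such that $\mathfrak h$ is admissible on $\mu(\Omega)$, the moment map is a bivector map from $(M,P_M^{\mathfrak h})$ to $(S,P_S^{\mathfrak h})$, i.e. $\mu_*P_M^{\mathfrak h}=P_S^{\mathfrak h}$ on $\Omega$: for every $m\in\Omega$, $\bigwedge^2(T_m\mu)\big(P_M^{\mathfrak h}(m)\big)=P_S^{\mathfrak h}(\mu(m))$.
   Context: Everything is real, finite-dimensional and smooth; ''bivector'' on a manifold means bivector field. $a\wedge b=a\otimes b-b\otimes a$. Manin pair $(\mathfrak d,\mathfrak g)$: a Lie algebra $\mathfrak d$ of dimension $2n$ with an invariant nondegenerate symmetric bilinear form $(\cdot|\cdot)$ of signature $(n,n)$, and a Lie subalgebra $\mathfrak g\subset\mathfrak d$ that is a maximal isotropic subspace. A Manin quasi-triple $(\mathfrak d,\mathfrak g,\mathfrak h)$ is a Manin pair with an isotropic linear complement $\mathfrak h$, $\mathfrak d=\mathfrak g\oplus\mathfrak h$. $p_{\mathfrak g},p_{\mathfrak h}$ are the projections; $j:\mathfrak g^*\to\mathfrak h$ is the isomorphism with $(j(\xi)|x)=\langle\xi,x\rangle$. $F_{\mathfrak h}:\mathfrak g\to\bigwedge^2\mathfrak g$ is given by $F_{\mathfrak h}(x)(\xi,\eta)=\langle j^{-1}p_{\mathfrak h}[j\xi,j\eta],x\rangle$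 and $\varphi_{\mathfrak h}\in\bigwedge^3\mathfrak g$ by $\varphi_{\mathfrak h}(\xi,\eta,\zeta)=\langle\zeta,p_{\mathfrak g}[j\xi,j\eta]\rangle$. If $\mathfrak h'$ is another isotropic complement with isomorphism $j'$, the twist from $\mathfrak h$ to $\mathfrak h'$ is $t=j'-j:\mathfrak g^*\to\mathfrak g$, regarded as $t\in\bigwedge^2\mathfrak g$ via $t(\xi,\eta)=\langle t(\xi),\eta\rangle$. Group pair $(D,G)$: a connected Lie group $D$ with a bi-invariant scalar product and a connected closed Lie subgroup $G$ whose Lie algebras form a Manin pair $(\mathfrak d,\mathfrak g)$. With a basis $(e_i)$ of $\mathfrak g$ and dual basis $(\varepsilon^i)$ of $\mathfrak g^*$, $r_{\mathfrak d}=\sum_i e_i\otimes j(\varepsilon^i)$. $G_D^{\mathfrak h}$ is $G$ with the bivector obtained by restricting $P_D^{\mathfrak h}=r_{\mathfrak d}^\lambda-r_{\mathfrak d}^\rho$ (left- minus right-invariant tensors) to $G$ and with $\varphi_{\mathfrak h}$ (a quasi-Poisson Lie group). $S=D/G$; the dressing action is the action of $D$ (and of $G\subset D$) on $S$ induced by left multiplication. For an action on a manifold $M$, $x_M$ is the vector field $(x_Mf)(m)=\frac{d}{dt}f(\exp(-tx)m)|_{t=0}$, extended multiplicatively to tensors; likewise $X_S$ for $X\in\mathfrak d$. $P_S^{\mathfrak h}=-\sum_i(e_i)_S\otimes(j\varepsilon^i)_S$ is the bivector on $S$ that is the projection of $P_D^{\mathfrak h}$. $\mathfrak h$ is admissible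 at $s\in S$ if $\mathfrak h\to T_sS$, $\xi\mapsto\xi_S(s)$, is an isomorphism, and admissible on a subset if admissible at each of its points. Where $\mathfrak h$ is admissible, for $x\in\mathfrak g$ the $1$-form $\hat x_{\mathfrak h}$ on $S$ is defined by $\langle\hat x_{\mathfrak h},\xi_S\rangle=-(x|\xi)$ for all $\xi\in\mathfrak h$. The action of $G_D^{\mathfrak h}$ on $(M,P_M^{\mathfrak h})$ is quasi-Poisson if $\frac12[P_M^{\mathfrak h},P_M^{\mathfrak h}]=(\varphi_{\mathfrak h})_M$ and $\mathcal L_{x_M}P_M^{\mathfrak h}=-F_{\mathfrak h}(x)_M$ for $x\in\mathfrak g$ (Schouten bracket normalized by $\frac12[P,P](df,dg,dh)=\{f,\{g,h\}\}+$cyclic, $\{f,g\}=P(df,dg)$). When $\mathfrak h$ is replaced by $\mathfrak h'$, $P_M^{\mathfrak h}$ is replaced by $P_M^{\mathfrak h'}=P_M^{\mathfrak h}-t_M$. For a bivector $P$, $P^\sharp$ maps $1$-forms to vector fields by $\langle P^\sharp\alpha,\beta\rangle=P(\beta,\alpha)$. A moment map for a quasi-Poisson action is a map $\mu:M\to S$, equivariant for the $G$-action on $M$ and the dressing action of $G$ on $S$, such that on any open $\Omega\subset M$, $(P_M^{\mathfrak h})^\sharp(\mu^*\hat x_{\mathfrak h})=x_M$ for all $x\in\mathfrak g$ and any $\mathfrak h$ admissible on $\mu(\Omega)$. A quasi-hamiltonian space is a manifold with bivector carrying a quasi-Poisson action that admits a moment map. *)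

(* Defs.v *)
(* MathComp-Analysis: real, finite-dimensional, C^infinity differential geometry
   over an arbitrary R : realType. *)
From HB Require Import structures.
From mathcomp Require Import all_boot all_order all_algebra.
From mathcomp Require Import all_classical all_reals all_analysis.

Set Implicit Arguments.
Unset Strict Implicit.
Unset Printing Implicit Defensive.

Import Order.TTheory GRing.Theory Num.Theory.
Import numFieldNormedType.Exports.

Local Open Scope classical_set_scope.
Local Open Scope ring_scope.

(* [U] is meant to be open and [V] finite-dimensional. *)
Fixpoint Ck (R : realType) (V : normedModType R) (k : nat) (U : set V)
    (f : V -> R^o) : Prop :=
  match k with
  | 0 => forall x, U x -> {for x, continuous f}
  | k'.+1 => (forall x, U x -> differentiable f x) /\
             (forall v, Ck k' U (fun x => 'D_v f x))
  end.

Definition Cinfty_at (R : realType) (V : normedModType R) (x : V)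
    (f : V -> R^o) : Prop :=
  exists2 U : set V, open_nbhs x U & forall k, Ck k U f.

(* [smooth_at p f]: the germ of [f] at [p] belongs to the stalk at [p] of the
   sheaf of smooth functions. *)
Record smoothSpace (R : realType) := SmoothSpace {
  ss_top :> topologicalType;
  smooth_at : ss_top -> (ss_top -> R) -> Prop;
  smooth_at_germ : forall p f g,
    (\forall q \near p, f q = g q) -> smooth_at p f -> smooth_at p g;
  smooth_at_cst : forall p a, smooth_at p (fun=> a);
  smooth_atD : forall p f g, smooth_at p f -> smooth_at p g ->
    smooth_at p (fun q => f q + g q);
  smooth_atM : forall p f g, smooth_at p f -> smooth_at p g ->
    smooth_at p (fun q => f q * g q)
}.

Definition smooth (R : realType) (M : smoothSpace R) (f : M -> R) : Prop :=
  forall p, smooth_at p f.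

Record smoothMap (R : realType) (M N : smoothSpace R) := SmoothMap {
  sm_fun :> M -> N;
  sm_continuous : continuous sm_fun;
  sm_smooth : forall p f, smooth_at (sm_fun p) f -> smooth_at p (f \o sm_fun)
}.

(* [phi] restricts to a homeomorphism, with inverse [psi], from the open set [U]
   onto an open set of R^n, which matches the sheaves of smooth functions. *)
Definition is_chart (R : realType) (M : smoothSpace R) (n : nat) (U : set M)
    (phi : M -> 'rV[R]_n) (psi : 'rV[R]_n -> M) : Prop :=
  [/\ open U /\ open (phi @` U),
      forall p, U p -> psi (phi p) = p,
      forall p, U p -> {for p, continuous phi} /\ {for phi p, continuous psi} &
      forall p f, U p -> (smooth_at p f <-> Cinfty_at (phi p) (f \o psi))].

Record manifold (R : realType) := Manifold {
  mf_space :> smoothSpace R;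
  mf_dim : nat;
  mf_hausdorff : hausdorff_space mf_space;
  mf_second_countable : @second_countable mf_space;
  mf_charts : forall p : mf_space,
    exists U (phi : mf_space -> 'rV[R]_mf_dim) psi, is_chart U phi psi /\ U p
}.

(* Smoothness of a function on the product manifold M x N, in product charts. *)
Definition smooth2_at (R : realType) (M N : manifold R) (F : M -> N -> R)
    (p : M) (q : N) : Prop :=
  forall (U : set M) (phi : M -> 'rV[R]_(mf_dim M)) psi
         (V : set N) (phi' : N -> 'rV[R]_(mf_dim N)) psi',
    is_chart U phi psi -> U p -> is_chart V phi' psi' -> V q ->
    Cinfty_at (phi p, phi' q) (fun z => F (psi z.1) (psi' z.2)).

(* Derivations at [p] of the algebra of smooth functions.  They are extended by 0
   to the functions that are not smooth, so as to be uniquely determined as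
   operators on [M -> R]. *)
Definition is_tangent (R : realType) (M : smoothSpace R) (p : M)
    (v : (M -> R) -> R^o) : Prop :=
  [/\ forall a f g, smooth f -> smooth g ->
        v (fun q => a * f q + g q) = a * v f + v g,
      forall f g, smooth f -> smooth g ->
        v (fun q => f q * g q) = f p * v g + g p * v f &
      forall f, ~ smooth f -> v f = 0].

Definition tangent_pred (R : realType) (M : smoothSpace R) (p : M) :
  {pred (M -> R) -> R^o} := fun v => `[< is_tangent p v >].
Arguments tangent_pred {R} M p _ : simpl never.

Lemma tangent_submod_closed (R : realType) (M : smoothSpace R) (p : M) :
  submod_closed (tangent_pred M p).
Proof.
split=> [|a u v /asboolP[uD uM u0] /asboolP[vD vM v0]].
  by apply/asboolP; split=> //= *; rewrite ?mulr0 ?addr0.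
apply/asboolP; split=> [b f g sf sg|f g sf sg|f sf] /=.
- rewrite !fctE uD// vD//= /GRing.scale/=.
  by rewrite !mulrDr addrACA mulrCA.
- rewrite !fctE uM// vM//= /GRing.scale/=.
  by rewrite !mulrDr addrACA (mulrCA a) (mulrCA a).
- by rewrite !fctE u0// v0// scaler0 addr0.
Qed.

HB.instance Definition _ (R : realType) (M : smoothSpace R) (p : M) :=
  GRing.isSubmodClosed.Build R ((M -> R) -> R^o) (tangent_pred M p)
    (tangent_submod_closed p).

Record tangent (R : realType) (M : smoothSpace R) (p : M) := Tangent {
  tv :> (M -> R) -> R^o;
  _ : tv \in tangent_pred M p
}.
Arguments tangent {R} M p.

HB.instance Definition _ (R : realType) (M : smoothSpace R) (p : M) :=
  [isSub for @tv R M p].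
HB.instance Definition _ (R : realType) (M : smoothSpace R) (p : M) :=
  [Choice of tangent M p by <:].
HB.instance Definition _ (R : realType) (M : smoothSpace R) (p : M) :=
  [SubChoice_isSubLmodule of tangent M p by <:].

Notation cotangent M p := {scalar tangent M p}.

Definition differential_fun (R : realType) (M : smoothSpace R) (p : M)
  (f : M -> R) (v : tangent M p) : R := v f.

Lemma differential_scalar (R : realType) (M : smoothSpace R) (p : M)
  (f : M -> R) : scalar (@differential_fun R M p f).
Proof. by []. Qed.

HB.instance Definition _ (R : realType) (M : smoothSpace R) (p : M)
    (f : M -> R) :=
  GRing.isLinear.Build R (tangent M p) R *%R (@differential_fun R M p f)
    (differential_scalar f).

Definition differential (R : realType) (M : smoothSpace R) (f : M -> R)
  (p : M) : cotangent M p := @differential_fun R M p f.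

Section TangentMap.
Context (R : realType) (M N : smoothSpace R) (mu : smoothMap M N) (p : M).

Definition tangent_map_fun (v : tangent M p) : (N -> R) -> R^o :=
  fun f => if `[< smooth f >] then v (f \o mu) else 0.

Lemma tangent_map_subproof v :
  tangent_map_fun v \in tangent_pred N (mu p).
Proof.
have smu f : smooth f -> smooth (f \o mu) by move=> sf q; exact: sm_smooth.
case: v => v vP; have /asboolP[vD vM v0] := vP.
apply/asboolP; rewrite /tangent_map_fun /=; split=> [a f g sf sg|f g sf sg|f sf].
- rewrite !asboolT//; first exact: vD (smu _ sf) (smu _ sg).
  by move=> q; apply: smooth_atD => //; apply: smooth_atM => //; exact: smooth_at_cst.
- rewrite !asboolT//; first exact: vM (smu _ sf) (smu _ sg).
  by move=> q; exact: smooth_atM.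
- by rewrite asboolF.
Qed.

Definition tangent_map (v : tangent M p) : tangent N (mu p) :=
  Tangent (tangent_map_subproof v).

Lemma tangent_map_linear : linear tangent_map.
Proof.
move=> a u v; apply/val_inj/funext => f.
change (tangent_map_fun (a *: u + v) f =
        a * tangent_map_fun u f + tangent_map_fun v f).
by rewrite /tangent_map_fun; case: ifP => // _; rewrite mulr0 addr0.
Qed.

HB.instance Definition _ :=
  GRing.isLinear.Build R (tangent M p) (tangent N (mu p)) *:%R tangent_map
    tangent_map_linear.

Definition pullback (alpha : cotangent N (mu p)) : cotangent M p :=
  alpha \o tangent_map.

End TangentMap.

(* Elements of the tensor square of the (finite-dimensional) tangent space at [p],
   identified with bilinear forms on covectors;
   a (x) b is [fun alpha beta => alpha a * beta b]. *)
Definition tensor2 (R : realType) (M : smoothSpace R) (p : M) : Type :=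
  cotangent M p -> cotangent M p -> R.
Arguments tensor2 {R} M p.

Definition pushforward2 (R : realType) (M N : smoothSpace R)
    (mu : smoothMap M N) (p : M) (T : tensor2 M p) : tensor2 N (mu p) :=
  fun alpha beta => T (pullback alpha) (pullback beta).

Arguments pushforward2 {R M N} mu {p} T.

(* The vector [v] is P^sharp(alpha). *)
Definition is_sharp (R : realType) (M : smoothSpace R) (p : M)
    (T : tensor2 M p) (alpha : cotangent M p) (v : tangent M p) : Prop :=
  forall beta : cotangent M p, beta v = T beta alpha.

Definition poisson (R : realType) (M : smoothSpace R)
    (P : forall p : M, tensor2 M p) (f g : M -> R) : M -> R :=
  fun p => P p (differential f p) (differential g p).

Record bivector (R : realType) (M : smoothSpace R) := Bivector {
  bv :> forall p : M, tensor2 M p;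
  bv_linear : forall p a (alpha alpha' beta : cotangent M p),
    bv (a \*: (alpha : _ -> R^o) \+ alpha' : cotangent M p) beta =
    a * bv alpha beta + bv alpha' beta;
  bv_skew : forall p (alpha beta : cotangent M p),
    bv alpha beta = - bv beta alpha;
  bv_smooth : forall f g : M -> R, smooth f -> smooth g ->
    smooth (poisson bv f g)
}.

Record lieAlgebra (R : realType) := LieAlgebra {
  la_space :> vectType R;
  la_br : {bilinear la_space -> la_space -> la_space};
  la_alt : forall x, la_br x x = 0;
  la_jacobi : forall x y z,
    la_br x (la_br y z) + la_br y (la_br z x) + la_br z (la_br x y) = 0
}.

(* A Lie group, together with its Lie algebra and its exponential map.  The
   last five fields say that, for each [x], [t |-> exp(tx)] is a smooth
   one-parameter subgroup, that sending [x] to its velocity at the identity is a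
   linear isomorphism from the Lie algebra onto the tangent space at the
   identity, and that the bracket is the commutator of left-invariant vector
   fields; these data are therefore determined by the group up to a unique
   isomorphism of Lie algebras. *)
Record lieGroup (R : realType) := LieGroup {
  lg_mf :> manifold R;
  lg_mul : lg_mf -> lg_mf -> lg_mf;
  lg_one : lg_mf;
  lg_inv : lg_mf -> lg_mf;
  lg_mulA : forall a b c, lg_mul a (lg_mul b c) = lg_mul (lg_mul a b) c;
  lg_mul1 : forall a, lg_mul lg_one a = a;
  lg_mulV : forall a, lg_mul (lg_inv a) a = lg_one;
  lg_mul_continuous : continuous (fun z : lg_mf * lg_mf => lg_mul z.1 z.2);
  lg_mul_smooth : forall a b f, smooth_at (lg_mul a b) f ->
    smooth2_at (fun a b => f (lg_mul a b)) a b;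
  lg_inv_continuous : continuous lg_inv;
  lg_inv_smooth : forall a f, smooth_at (lg_inv a) f ->
    smooth_at a (f \o lg_inv);
  lg_lie : lieAlgebra R;
  lg_exp : lg_lie -> lg_mf;
  lg_exp_add : forall s t x,
    lg_exp ((s + t) *: x) = lg_mul (lg_exp (s *: x)) (lg_exp (t *: x));
  lg_exp_smooth : forall x, continuous (fun t : R^o => lg_exp (t *: x)) /\
    forall t f, smooth_at (lg_exp (t *: x)) f ->
      @Cinfty_at R R^o t (fun s => f (lg_exp (s *: x)));
  lg_exp_linear : forall a x y f, smooth_at lg_one f ->
    derive1 (fun t : R => f (lg_exp (t *: (a *: x + y)))) 0 =
    a * derive1 (fun t : R => f (lg_exp (t *: x))) 0 +
    derive1 (fun t : R => f (lg_exp (t *: y))) 0;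
  lg_exp_tangent : forall v : tangent lg_mf lg_one, exists! x,
    forall f, smooth f -> v f = derive1 (fun t : R => f (lg_exp (t *: x))) 0;
  lg_bracket : forall x y f a, smooth f ->
    let left_invariant z (k : lg_mf -> R) : lg_mf -> R :=
      fun b => derive1 (fun t : R => k (lg_mul b (lg_exp (t *: z)))) 0 in
    left_invariant (la_br lg_lie x y) f a =
    left_invariant x (left_invariant y f) a -
    left_invariant y (left_invariant x f) a
}.

(* Ad_a x is the only element of the set below. *)
Definition adjoint (R : realType) (D : lieGroup R) (a : D) (x : lg_lie D) :
    lg_lie D :=
  xget 0 [set y | forall t : R, lg_exp (t *: y) =
                    lg_mul (lg_mul a (lg_exp (t *: x))) (lg_inv a)].

Definition closed_subgroup (R : realType) (D : lieGroup R) (G : set D) : Prop :=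
  [/\ G (lg_one D), forall a b, G a -> G b -> G (lg_mul a b),
      forall a, G a -> G (lg_inv a) & closed G].

(* [g] is the Lie algebra of the closed subgroup [G]. *)
Definition subgroup_lie_algebra (R : realType) (D : lieGroup R) (G : set D)
    (g : {vspace lg_lie D}) : Prop :=
  forall x, x \in g <-> forall t : R, G (lg_exp (t *: x)).

(* The homogeneous space D/G of left cosets aG, with the quotient topology; a
   function is smooth when its pullback to D is. *)
Section Homogeneous.
Context (R : realType) (D : lieGroup R) (G : set D).
Local Open Scope quotient_scope.

Definition same_coset (a b : D) : bool :=
  `[< [set lg_mul a c | c in G] = [set lg_mul b c | c in G] >].

Lemma same_coset_equiv : equiv_class_of same_coset.
Proof.
split=> [a|a b|b a c].
- exact/asboolP.
- by apply/asboolP/asboolP => ->.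
- by move=> /asboolP ab /asboolP bc; apply/asboolP; rewrite ab.
Qed.

Canonical same_coset_rel := EquivRelPack same_coset_equiv.

Definition coset_space : topologicalType :=
  quotient_topology {eq_quot same_coset_rel}.

Definition coset (a : D) : coset_space := \pi_coset_space a.

Definition coset_smooth_at (s : coset_space) (f : coset_space -> R) : Prop :=
  forall a, coset a = s -> smooth_at a (f \o coset).

Lemma coset_smooth_at_germ s f g : (\forall q \near s, f q = g q) ->
  coset_smooth_at s f -> coset_smooth_at s g.
Proof.
move=> fg sf a as_; apply: smooth_at_germ (sf a as_).
rewrite -as_ in fg.
exact: (@pi_continuous D {eq_quot same_coset_rel} a _ fg).
Qed.

Definition homogeneous : smoothSpace R.
Proof.
refine (@SmoothSpace R coset_space coset_smooth_at coset_smooth_at_germ _ _ _).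
- by move=> s c a _; exact: smooth_at_cst.
- by move=> s f g sf sg a as_; apply: smooth_atD; [exact: sf|exact: sg].
- by move=> s f g sf sg a as_; apply: smooth_atM; [exact: sf|exact: sg].
Defined.

(* The dressing action, induced by left multiplication. *)
Definition dressing (a : D) (s : homogeneous) : homogeneous :=
  coset (lg_mul a (repr s)).

End Homogeneous.

Section Manin.
Context (R : realType) (d : lieAlgebra R) (B : {biscalar d}) (g : {vspace d}).
Implicit Types h : {vspace d}.

Definition isotropic (U : {vspace d}) : Prop :=
  forall x y, x \in U -> y \in U -> B x y = 0.

(* The vectors [p i] and [q i] together are an orthogonal basis of [d]
   when [d] has dimension 2n. *)
Definition split_signature (n : nat) : Prop :=
  exists p q : 'I_n -> d,
    [/\ forall i j, B (p i) (p j) = (i == j)%:R,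
        forall i j, B (q i) (q j) = - (i == j)%:R &
        forall i j, B (p i) (q j) = 0].

Definition manin_pair (n : nat) : Prop :=
  [/\ \dim {:d} = (2 * n)%N,
      [/\ forall x y, B x y = B y x,
          forall x, (forall y, B x y = 0) -> x = 0,
          forall x y z, B (la_br d x y) z = B x (la_br d y z) &
          split_signature n],
      forall x y, x \in g -> y \in g -> la_br d x y \in g &
      isotropic g /\ forall U : {vspace d}, isotropic U -> (g <= U)%VS -> U = g].

(* (d, g, h) is a Manin quasi-triple, given that (d, g) is a Manin pair. *)
Definition isotropic_complement h : Prop :=
  [/\ isotropic h, (g + h)%VS = fullv & (g :&: h)%VS = 0%VS].

Definition gdual : vectType R := 'Hom(subvs_of g, R^o).

(* The map j from g^* to h.  When (d, g, h) is a quasi-triple the sets of which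
   [jmap] and [jinv] (on h) pick an element are singletons. *)
Definition jmap h (xi : gdual) : d :=
  xget 0 [set y | y \in h /\ forall x : subvs_of g, B y (vsval x) = xi x].

Definition jinv h (y : d) : gdual := xget 0 [set xi | jmap h xi = y].

Definition proj_g h (y : d) : subvs_of g := vsproj g (daddv_pi g h y).

Definition proj_h h (y : d) : d := daddv_pi h g y.

(* Elements of the second and third exterior powers of g are identified with
   multilinear forms on g^*. *)
Definition Fmap h (x : subvs_of g) (xi eta : gdual) : R :=
  jinv h (proj_h h (la_br d (jmap h xi) (jmap h eta))) x.

Definition varphi h (xi eta zeta : gdual) : R :=
  zeta (proj_g h (la_br d (jmap h xi) (jmap h eta))).

(* The twist t from h to h', with t(xi, eta) = <t(xi), eta>; the difference
   j' - j takes its values in g, on which [vsproj g] is the identity. *)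
Definition twist h h' (xi eta : gdual) : R :=
  eta (vsproj g (jmap h' xi - jmap h xi)).

Definition gbasis (i : 'I_(\dim {:subvs_of g})) : subvs_of g :=
  (vbasis {:subvs_of g})`_i.

Definition gcobasis (i : 'I_(\dim {:subvs_of g})) : gdual :=
  linfun (coord (vbasis {:subvs_of g}) i : subvs_of g -> R^o).

End Manin.

(* (D, G) is a group pair, with Manin pair (lg_lie D, g).  The bi-invariant
   scalar product on D is given by its value [B] at the identity. *)
Definition group_pair (R : realType) (D : lieGroup R) (G : set D) (n : nat)
    (B : {biscalar lg_lie D}) (g : {vspace lg_lie D}) : Prop :=
  [/\ connected [set: D], closed_subgroup G /\ connected G,
      subgroup_lie_algebra G g,
      forall a x y, B (adjoint a x) (adjoint a y) = B x y &
      manin_pair B g n].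

Section FundamentalFields.
Context (R : realType) (D : lieGroup R) (M : smoothSpace R) (act : D -> M -> M).

(* [fundamental x m] is x_M(m).  For a smooth action the function of [f] below is
   always a derivation at [m], so that the default value 0 of [insubd] is never
   used: [insubd] only bundles the derivation with its defining property. *)
Definition fundamental (x : lg_lie D) (m : M) : tangent M m :=
  insubd (0 : tangent M m) (fun f : M -> R =>
    if `[< smooth f >]
    then derive1 (fun t : R => f (act (lg_exp (- t *: x)) m)) 0 else 0).

Definition fundamental_der (x : lg_lie D) (f : M -> R) : M -> R :=
  fun m => fundamental x m f.

Context (g : {vspace lg_lie D}).

Definition fundamental2 (T : gdual g -> gdual g -> R) (m : M) : tensor2 M m :=
  fun alpha beta => \sum_i \sum_j T (gcobasis i) (gcobasis j) *
    (alpha (fundamental (vsval (gbasis i)) m) *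
     beta (fundamental (vsval (gbasis j)) m)).

Definition fundamental3 (T : gdual g -> gdual g -> gdual g -> R) (m : M)
    (alpha beta gamma : cotangent M m) : R :=
  \sum_i \sum_j \sum_k T (gcobasis i) (gcobasis j) (gcobasis k) *
    (alpha (fundamental (vsval (gbasis i)) m) *
     beta (fundamental (vsval (gbasis j)) m) *
     gamma (fundamental (vsval (gbasis k)) m)).

End FundamentalFields.

(* A smooth action on [M] of the closed Lie subgroup [G] of [D]; the values of
   [act] outside of [G] are irrelevant.  As [G] is an embedded submanifold of
   [D], a function is smooth on G x M when it extends locally to a smooth
   function on D x M. *)
Definition smooth_action (R : realType) (D : lieGroup R) (G : set D)
    (M : manifold R) (act : D -> M -> M) : Prop :=
  [/\ forall m, act (lg_one D) m = m,
      forall a b m, G a -> G b -> act (lg_mul a b) m = act a (act b m),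
      {within G `*` [set: M], continuous (fun z : D * M => act z.1 z.2)} &
      forall a m f, G a -> smooth_at (act a m) f ->
        exists2 F : D -> M -> R, smooth2_at F a m &
          \forall z \near (a, m), G z.1 -> f (act z.1 z.2) = F z.1 z.2].

Section QuasiPoisson.
Context (R : realType) (D : lieGroup R) (G : set D) (B : {biscalar lg_lie D})
  (g : {vspace lg_lie D}).
Local Notation S := (homogeneous G).

(* -sum_i (e_i)_S (x) (j eps^i)_S *)
Definition dressing_bivector (h : {vspace lg_lie D}) (s : S) : tensor2 S s :=
  fun alpha beta => - \sum_i
    alpha (fundamental (@dressing R D G) (vsval (gbasis i)) s) *
    beta (fundamental (@dressing R D G) (jmap B h (gcobasis (g := g) i)) s).

(* The map is linear, so that bijective means isomorphism. *)
Definition admissible_at (h : {vspace lg_lie D}) (s : S) : Prop :=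
  bijective (fun xi : subvs_of h =>
    fundamental (@dressing R D G) (vsval xi) s).

Definition admissible_on (h : {vspace lg_lie D}) (A : set S) : Prop :=
  forall s, A s -> admissible_at h s.

(* [alpha] is the value at [s] of the 1-form \hat x_h. *)
Definition is_hat (h : {vspace lg_lie D}) (x : subvs_of g) (s : S)
    (alpha : cotangent S s) : Prop :=
  forall xi, xi \in h ->
    alpha (fundamental (@dressing R D G) xi s) = - B (vsval x) xi.

Context (M : manifold R) (act : D -> M -> M).

(* (L_X P)(df, dg) for X = x_M *)
Definition lie_derivative (x : lg_lie D) (P : forall m : M, tensor2 M m)
    (u v : M -> R) : M -> R :=
  fun m => fundamental_der act x (poisson P u v) m
           - poisson P (fundamental_der act x u) v m
           - poisson P u (fundamental_der act x v) m.

Definition quasi_poisson (h : {vspace lg_lie D}) (P : bivector M) : Prop :=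
  (forall (u v w : M -> R) (m : M), smooth u -> smooth v -> smooth w ->
     poisson P u (poisson P v w) m + poisson P v (poisson P w u) m
       + poisson P w (poisson P u v) m =
     fundamental3 act (varphi B h : gdual g -> _)
       (differential u m) (differential v m) (differential w m)) /\
  (forall (x : subvs_of g) (u v : M -> R) (m : M), smooth u -> smooth v ->
     lie_derivative (vsval x) P u v m =
     - fundamental2 act (Fmap B h x) (differential u m) (differential v m)).

(* P^{h'} = P^h - t_M *)
Definition twisted_bivector (h h' : {vspace lg_lie D}) (P : bivector M) (m : M) :
    tensor2 M m :=
  fun alpha beta =>
    P m alpha beta - fundamental2 act (twist B h h' : gdual g -> _) alpha beta.

Arguments twisted_bivector h h' P m : clear implicits.

Definition equivariant (mu : M -> S) : Prop :=
  forall a m, G a -> mu (act a m) = dressing a (mu m).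

Definition moment_map (h : {vspace lg_lie D}) (P : bivector M)
    (mu : smoothMap M S) : Prop :=
  equivariant mu /\
  forall (Omega : set M) (h' : {vspace lg_lie D}),
    open Omega -> isotropic_complement B g h' ->
    admissible_on h' (mu @` Omega) ->
    forall (x : subvs_of g) (m : M) (alpha : cotangent S (mu m)),
      Omega m -> is_hat h' x alpha ->
      is_sharp (twisted_bivector h h' P m) (pullback alpha)
        (fundamental act (vsval x) m).

End QuasiPoisson.
Arguments dressing_bivector {R D G} B g h s _ _.

(* Main.v *)
(* Fix m and put s = mu m.  As g and h are isotropic and B is nondegenerate, B
   pairs g and h perfectly, so every covector alpha at s is the value of some
   hat x, x in g.  The moment map condition says P(gamma, mu^* alpha) =
   gamma(x_M) for every covector gamma at m.  For gamma = mu^* beta,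
   equivariance of mu turns the right-hand side into beta(x_S).  Expanding x in
   the basis (e_i), with coordinates <eps^i, x> = B(x, j eps^i) =
   - alpha((j eps^i)_S), gives P_S(beta, alpha). *)
Require Import Defs.
From HB Require Import structures.
From mathcomp Require Import all_boot all_order all_algebra.
From mathcomp Require Import all_classical all_reals all_analysis.

Set Implicit Arguments.
Unset Strict Implicit.
Unset Printing Implicit Defensive.

Import Order.TTheory GRing.Theory Num.Theory.
Import numFieldNormedType.Exports.

Local Open Scope classical_set_scope.
Local Open Scope ring_scope.

(** * Slices of smooth functions of two variables *)

Lemma continuous_pairl (S T : topologicalType) (b : T) :
  continuous (fun a : S => (a, b)).
Proof. by move=> a; apply: cvg_pair; [exact: cvg_id|exact: cvg_cst]. Qed.

(** Along the slice, differentiating in direction [v] amounts to differentiating [f] in direction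
    [(v, 0)], so the induction on [k] passes to that derivative. *)
Lemma Ck_slice (R : realType) (V W : normedModType R) (w : W) k (U : set (V * W))
    (f : V * W -> R^o) :
  Ck k U f -> Ck k [set v | U (v, w)] (fun v => f (v, w)).
Proof.
elim: k U f => [|k IH] U f /=.
  move=> fU x Ux; apply: (@continuous_comp V (V * W)%type R^o (pair^~ w) f).
    exact: continuous_pairl.
  exact: fU.
move=> [df dCk]; split=> [x Ux|v].
  apply: (@differentiable_comp R V (V * W)%type R^o (pair^~ w) f).
    exact: (@differentiable_pair R V V W id (cst w)).
  exact: df.
have -> : (fun x => 'D_v (fun v => f (v, w)) x) =
    (fun x => 'D_(v, 0) f (x, w)).
  apply/funext => x; rewrite /derive.
  suff -> : (fun t : R => t^-1 *: (f (t *: v + x, w) - f (x, w))) =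
      (fun t => t^-1 *: (f (t *: (v, 0) + (x, w)) - f (x, w))) by [].
  apply/funext => t; congr (_ *: (f _ - _)).
  transitivity (t *: v + x, t *: (0 : W) + w) => //.
  by rewrite scaler0 add0r.
exact: IH (dCk (v, 0)).
Qed.

(** One pair of charts is enough: restricting to the slice at [phi' q] gives smoothness in the chart
    at [p], since [psi'] sends [phi' q] back to [q]. *)
Lemma smooth2_at_slice (R : realType) (M N : manifold R) (F : M -> N -> R)
    (p : M) (q : N) :
  smooth2_at F p q -> smooth_at p (F^~ q).
Proof.
move=> sF.
have [U [phi [psi [chU Up]]]] := mf_charts p.
have [V [phi' [psi' [chV Vq]]]] := mf_charts q.
have [W [oW Wpq] CkW] := sF _ _ _ _ _ _ chU Up chV Vq.
have [_ _ _ smU] := chU; have [_ psiK _ _] := chV.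
apply/(smU _ _ Up); exists [set u | W (u, phi' q)]; last first.
  move=> k; have := Ck_slice (phi' q) (CkW k).
  by rewrite /= psiK.
split=> //; by apply: open_comp oW => u _; exact: continuous_pairl.
Qed.

(** * Derivatives along one-parameter subgroups *)

Section OneParameterSubgroups.
Context (R : realType) (D : lieGroup R).

Lemma lg_exp0 : lg_exp (0 : lg_lie D) = lg_one D.
Proof.
have := @lg_exp_add R D 0 0 0; rewrite addr0 scaler0.
move=> /(congr1 (lg_mul (lg_inv (lg_exp (0 : lg_lie D))))).
by rewrite lg_mulA lg_mulV lg_mul1.
Qed.

(** As exp(-tx) = exp(t(-x)), the curve is the one-parameter subgroup of [- x], smooth at t = 0,
    where it passes through the identity. *)
Lemma derivable_exp (x : lg_lie D) (f : D -> R) :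
  smooth_at (lg_one D) f ->
  derivable (fun t : R => f (lg_exp (- t *: x)) : R^o) 0 1.
Proof.
move=> sf.
have {}sf : smooth_at (lg_exp (0 *: - x)) f by rewrite scale0r lg_exp0.
have [_ /(_ 0 f sf)[U [oU U0] CkU]] := lg_exp_smooth (- x).
have -> : (fun t : R => f (lg_exp (- t *: x)) : R^o) =
    (fun t : R => f (lg_exp (t *: - x))).
  by apply/funext => t; rewrite scaleNr scalerN.
have [dU _] := CkU 1.
exact: diff_derivable (dU _ U0).
Qed.

Lemma derive_exp_linear a (x y : lg_lie D) (f : D -> R) :
  smooth_at (lg_one D) f ->
  derive1 (fun t : R => f (lg_exp (- t *: (a *: x + y)))) 0 =
  a * derive1 (fun t : R => f (lg_exp (- t *: x))) 0 +
  derive1 (fun t : R => f (lg_exp (- t *: y))) 0.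
Proof.
move=> sf; have := lg_exp_linear a (- x) (- y) sf.
have N (z : lg_lie D) : (fun t : R => f (lg_exp (t *: - z))) =
    (fun t => f (lg_exp (- t *: z))).
  by apply/funext => t; rewrite scaleNr scalerN.
by rewrite scalerN -opprD !N.
Qed.

End OneParameterSubgroups.

(** * Fundamental vector fields, and their transport by the moment map *)

Section Fundamental.
Context (R : realType) (D : lieGroup R) (M : smoothSpace R) (act : D -> M -> M).

(* [act 1 m = m] is what makes Leibniz' rule hold at [m]. *)
Lemma fundamentalE (x : lg_lie D) (m : M) :
  act (lg_one D) m = m ->
  (forall f : M -> R, smooth f ->
    derivable (fun t : R => f (act (lg_exp (- t *: x)) m) : R^o) 0 1) ->
  tv (fundamental act x m) = (fun f : M -> R =>
    if `[< smooth f >]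
    then derive1 (fun t : R => f (act (lg_exp (- t *: x)) m)) 0 else 0).
Proof.
(* Once the operator is known to be a derivation, [insubd] keeps it instead of returning its default
   0. *)
move=> act1 dact; rewrite /fundamental; apply: insubdK.
have act0 : act (lg_exp (- 0 *: x)) m = m by rewrite oppr0 scale0r lg_exp0.
apply/asboolP; split=> [a f k sf sk|f k sf sk|f nsf]; last by rewrite asboolF.
- rewrite !asboolT//; last first.
    move=> p; apply: smooth_atD => //.
    by apply: smooth_atM => //; exact: smooth_at_cst.
  rewrite !derive1E.
  have df := dact _ sf; have dk := dact _ sk.
  have := deriveD (derivableZ (k := a) df) dk.
  by rewrite deriveZ.
- rewrite !asboolT//; last by move=> p; exact: smooth_atM.
  rewrite !derive1E.
  by have := deriveM (dact _ sf) (dact _ sk); rewrite /= act0.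
Qed.

End Fundamental.

Section Dressing.
Context (R : realType) (D : lieGroup R) (G : set D).
Local Notation S := (homogeneous G).

(** With the representative of [s] fixed, the orbit map is a slice of the multiplication of [D]
    followed by [coset], and [f \o coset] is smooth by definition of the quotient structure. *)
Lemma smooth_dressing_orbit (s : S) (f : S -> R) :
  smooth f -> smooth_at (lg_one D) (fun a => f (dressing a s)).
Proof.
move=> sf.
have sfc : smooth_at (lg_mul (lg_one D) (repr s)) (f \o @coset R D G).
  exact: sf _ _ erefl.
exact: smooth2_at_slice (lg_mul_smooth sfc).
Qed.

Lemma dressing1 (s : S) : dressing (lg_one D) s = s.
Proof. by rewrite /dressing lg_mul1; exact: reprK. Qed.

Lemma dressing_fundamentalE (x : lg_lie D) (s : S) :
  tv (fundamental (@dressing R D G) x s) = (fun f : S -> R =>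
    if `[< smooth f >]
    then derive1 (fun t : R => f (dressing (lg_exp (- t *: x)) s)) 0 else 0).
Proof.
apply: fundamentalE; first exact: dressing1.
by move=> f sf; apply: derivable_exp (smooth_dressing_orbit s sf).
Qed.

(** The arguments of [fundamental] are reordered so that, at fixed [s], the dependence on [x] can
    carry a linear structure. *)
Definition dressing_field (s : S) (x : lg_lie D) : tangent S s :=
  fundamental (@dressing R D G) x s.

Lemma dressing_field_linear (s : S) : linear (dressing_field s).
Proof.
move=> a x y; apply/val_inj/funext => f.
change (tv (dressing_field s (a *: x + y)) f =
  a * tv (dressing_field s x) f + tv (dressing_field s y) f).
rewrite !dressing_fundamentalE.
case: asboolP => [sf|_]; last by rewrite mulr0 addr0.
exact: derive_exp_linear (smooth_dressing_orbit s sf).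
Qed.

HB.instance Definition _ (s : S) :=
  GRing.isLinear.Build R (lg_lie D) (tangent S s) *:%R (dressing_field s)
    (dressing_field_linear s).

End Dressing.

Section Action.
Context (R : realType) (D : lieGroup R) (G : set D) (g : {vspace lg_lie D})
  (M : manifold R) (act : D -> M -> M).
Context (Gg : subgroup_lie_algebra G g) (sact : smooth_action G act).

(** The action is smooth only along [G]. For [x] in [g] the curve exp(-tx) stays in [G], so near t =
    0 the function agrees with a local smooth extension [F] to D x M, whose slice at [m] is
    differentiable along the curve. *)
Lemma action_fundamentalE (x : lg_lie D) (m : M) : x \in g ->
  tv (fundamental act x m) = (fun f : M -> R =>
    if `[< smooth f >]
    then derive1 (fun t : R => f (act (lg_exp (- t *: x)) m)) 0 else 0).
Proof.
move=> /Gg xG; have [act1 _ _ act_smooth] := sact.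
apply: fundamentalE => // f sf.
have G1 : G (lg_one D) by have := xG 0; rewrite scale0r lg_exp0.
have [F sF fF] := act_smooth _ m f G1 (sf _).
apply: (@near_eq_derivable R R^o R^o (fun t => F (lg_exp (- t *: x)) m));
  last exact: derivable_exp (smooth2_at_slice sF).
have cexp : (fun t : R^o => (lg_exp (- t *: x), m)) @ (0 : R^o) --> (lg_one D, m).
  apply: cvg_pair => /=; last exact: cvg_cst.
  have [/(_ 0) + _] := lg_exp_smooth (- x).
  rewrite /continuous_at /= scale0r lg_exp0.
  by under eq_fun do rewrite scalerN -scaleNr.
have := cexp _ fF; rewrite /= !near_simpl.
by apply: filterS => t /= ->.
Qed.

(** For [x] in [g], exp(-tx) lies in [G], so [mu] carries the orbit curve of [m] to that of [mu m];
    the velocities correspond. *)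
Lemma equivariant_fundamental (mu : smoothMap M (homogeneous G))
    (x : lg_lie D) (m : M) : equivariant act mu -> x \in g ->
  tangent_map mu (fundamental act x m) =
  dressing_field (mu m) x.
Proof.
move=> eqv xg; apply/val_inj/funext => f.
change (tangent_map_fun mu (fundamental act x m) f =
  tv (dressing_field (mu m) x) f).
rewrite /tangent_map_fun dressing_fundamentalE; case: asboolP => // sf.
rewrite action_fundamentalE// asboolT; last by move=> q; exact: sm_smooth.
congr (derive1 _ 0); apply/funext => t /=.
by rewrite eqv//; exact: (Gg x).1.
Qed.

End Action.

(** * Duality between [g] and [h] under the scalar product *)

Section ManinQuasiTriple.
Context (R : realType) (d : lieAlgebra R) (B : {biscalar d}).

(** Nondegeneracy makes x -> B(x, .) injective; the dual of [d] has the same dimension as [d], so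
    this map is onto. *)
Lemma nondegenerate_represents (l : 'Hom(d, R^o)) :
  (forall x, (forall y, B x y = 0) -> x = 0) -> exists x, forall y, B x y = l y.
Proof.
move=> nd.
pose b x : 'Hom(d, R^o) := linfun (B x : d -> R^o).
have bE x y : b x y = B x y by rewrite lfunE.
have b_lin : linear b.
  move=> a x y; apply/lfunP => z.
  by rewrite add_lfunE scale_lfunE !bE linearPl.
pose bL := HB.pack_for {linear d -> 'Hom(d, R^o)} b
  (GRing.isLinear.Build _ _ _ _ b b_lin).
have kb : lker (linfun bL) == 0%VS.
  apply/eqP/vspaceP => x; rewrite memv_ker memv0 lfunE/=.
  apply/eqP/eqP => [bx0|->]; last exact: (linear0 bL).
  by apply: nd => y; rewrite -bE bx0 zero_lfunE.
have : limg (linfun bL) = fullv.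
  apply/eqP; rewrite eqEdim subvf limg_dim_eq; last by rewrite (eqP kb) capv0.
  by rewrite !dimvf /= /dim /= muln1.
move/vspaceP/(_ l); rewrite memvf => /memv_imgP[x _ ->].
by exists x => y; rewrite lfunE /= bE.
Qed.

Context (n : nat) (g h : {vspace d}).
Context (mp : manin_pair B g n) (ih : isotropic_complement B g h).

Lemma decomposition z : exists x y, [/\ x \in g, y \in h & z = x + y].
Proof.
have [_ gh _] := ih; have : z \in (g + h)%VS by rewrite gh memvf.
by case/memv_addP => x xg [y yh ->]; exists x, y.
Qed.

(** The choice in [jmap] is meaningful once its set is inhabited. Extend [xi] to [d] through
    [vsproj g] and represent it by a vector; as [g] is isotropic, the component of that vector in
    [h] has the same pairing with [g]. *)
Lemma jmapP (xi : gdual g) : jmap B h xi \in h /\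
  forall x : subvs_of g, B (jmap B h xi) (vsval x) = xi x.
Proof.
have [_ [_ nd _ _] _ [giso _]] := mp.
have [z zP] := nondegenerate_represents (xi \o linfun (vsproj g))%VF nd.
have [x [y [xg yh zE]]] := decomposition z.
rewrite /jmap; case: xgetP => // /(_ y)[]; split=> // u.
have := zP (vsval u); rewrite zE linearDl /= giso ?subvsP// add0r => ->.
by rewrite comp_lfunE lfunE /= vsvalK.
Qed.

(** The component in [h] of a representing vector pairs to 0 with [h], so minus its component in [g]
    works. The sign is that of the forms \hat x. *)
Lemma isotropic_represents (l : 'Hom(d, R^o)) :
  exists x : subvs_of g, forall y, y \in h -> l y = - B (vsval x) y.
Proof.
have [_ [_ nd _ _] _ _] := mp; have [hiso _ _] := ih.
have [z zP] := nondegenerate_represents l nd.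
have [x [y [xg yh zE]]] := decomposition z.
exists (- vsproj g x) => u uh.
rewrite linearN /= vsprojK// linearNl opprK -zP zE linearDl/=.
by rewrite (hiso y)// addr0.
Qed.

End ManinQuasiTriple.

Theorem theorem5p5p1 (R : realType) (D : lieGroup R) (G : set D) (n : nat)
    (B : {biscalar lg_lie D}) (g h : {vspace lg_lie D})
    (M : manifold R) (act : D -> M -> M) (P : bivector M)
    (mu : smoothMap M (homogeneous G)) :
  group_pair G n B g ->
  isotropic_complement B g h ->
  smooth_action G act ->
  quasi_poisson B g act h P ->
  moment_map B g act h P mu ->
  forall Omega : set M, open Omega -> admissible_on h (mu @` Omega) ->
  forall m : M, Omega m ->
    pushforward2 mu (P m) = dressing_bivector B g h (mu m).
Proof.
move=> [_ _ Gg _ mp] ih sact _ [eqv mom] Omega oOmega adm m Om.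
have [_ [Bsym _ _ _] _ _] := mp.
apply/funext => beta; apply/funext => alpha.
pose fS := @dressing_field R D G (mu m).
pose l : 'Hom(lg_lie D, R^o) := linfun (alpha \o fS : lg_lie D -> R^o).
have lE x : l x = alpha (fS x) by rewrite lfunE.
have [x xP] := isotropic_represents mp ih l.
have hatx : is_hat B h x alpha by move=> xi xih; rewrite -xP// lE.
have := mom _ _ oOmega ih adm x m alpha Om hatx (pullback beta).
(* The condition is taken at h' = h, where j' - j vanishes, so the twisted bivector is [P]
   itself. *)
rewrite /twisted_bivector [fundamental2 _ _ _ _]big1 ?subr0; last first.
  move=> i _; rewrite big1// => j _.
  by rewrite /twist subrr !linear0 mul0r.
rewrite /pushforward2 => <-.
rewrite /pullback /= (equivariant_fundamental Gg sact)//; last exact: subvsP.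
rewrite /dressing_bivector {1}(coord_vbasis (memvf x)) -sumrN !linear_sum.
apply: eq_bigr => i _; have [jh jB] := jmapP mp ih (gcobasis (g := g) i).
(* The sign in \hat x cancels the one in the dressing bivector; by symmetry of [B], what remains is
   the i-th coordinate of [x]. *)
rewrite !linearZ /= hatx// opprK Bsym jB lfunE.
exact: mulrC.
Qed.
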